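(* Let $u:A\rightarrow B$ be a ring morphism. The following are equivalent: (i) $u$ is a strong PSI-morphism. (ii) $u$ is a PSI-morphism and, for each $Q\in \mathrm{Spec}(B)$, the canonical map $k_A(u^{-1}(Q))\to k_B(Q)$ is an isomorphism. (iii) For each $P\in \mathrm{Spec}(A)$, $k_A(P)\otimes_A B$ is a $k_A(P)$-vector space of dimension $\leq 1$.
   Context: All rings are commutative and unitary, and ring morphisms are unitary. For a ring morphism $u:A\to B$, a proper ideal $I$ of $B$ is called $A$-prime if $u(a)b\in I$ with $a\in A$ and $b\in B$ implies that $u(a)\in I$ or $b\in I$. The morphism $u$ is a PSI-morphism if every $A$-prime ideal of $B$ is a prime ideal of $B$. For $P\in\mathrm{Spec}(A)$, $k_A(P)=A_P/PA_P$ denotes the residue field of $A$ at $P$ (similarly for $B$). The morphism $u$ is a strong PSI-morphism if for every $P\in\mathrm{Spec}(A)$ with $k_A(P)\otimes_A B\neq 0$, the canonical map $k_A(P)\to k_A(P)\otimes_A B$ is an isomorphism. *)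

(* Defs.v *)
From HB Require Import structures.
From mathcomp Require Import all_boot all_algebra ring.
From mathcomp Require Import boolp classical_sets.

Set Implicit Arguments.
Unset Strict Implicit.
Unset Printing Implicit Defensive.

Import GRing.Theory.
Local Open Scope classical_set_scope.
Local Open Scope ring_scope.
Local Open Scope quotient_scope.

(* Rings are [comPzRingType]s, so that the zero ring is allowed; ring_quotient *)
(* only has ideals of nontrivial rings, hence the definitions below.           *)

Section Ideals.
Variable R : comPzRingType.
Implicit Types I : set R.

Definition is_ideal I :=
  [/\ I 0, forall x y, I x -> I y -> I (x + y) & forall a x, I x -> I (a * x)].

Definition is_proper_ideal I := is_ideal I /\ ~ I 1.

Definition is_prime_ideal I :=
  is_proper_ideal I /\ forall x y, I (x * y) -> I x \/ I y.

Definition ideal_gen (X : set R) : set R :=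
  [set x | forall I, is_ideal I -> X `<=` I -> I x].

Lemma ideal_gen_is_ideal X : is_ideal (ideal_gen X).
Proof.
split=> [I [] //|x y Xx Xy I idI XI|a x Xx I idI XI].
  by case: (idI) => _ + _; apply; [apply: Xx | apply: Xy].
by case: (idI) => _ _; apply; apply: Xx.
Qed.

Lemma sub_ideal_gen X : X `<=` ideal_gen X.
Proof. by move=> x Xx I _; apply. Qed.

End Ideals.

Record spec (R : comPzRingType) :=
  Spec { spec_set :> set R; specP : is_prime_ideal spec_set }.

Section SpecPreimage.
Variables (A B : comPzRingType) (u : {rmorphism A -> B}) (Q : spec B).

Lemma preimage_is_prime : is_prime_ideal (u @^-1` Q).
Proof.
case: Q => I [[[I0 ID IM] I1] IP]; split; [split; [split|]|];
  rewrite /preimage /=.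
- by rewrite rmorph0.
- by move=> x y; rewrite rmorphD; apply: ID.
- by move=> a x; rewrite rmorphM; apply: IM.
- by rewrite rmorph1.
- by move=> x y; rewrite rmorphM => /IP.
Qed.

Definition spec_preimage : spec A := Spec preimage_is_prime.

End SpecPreimage.

Section Localization.
Variables (A : comPzRingType) (P : spec A).

Record denom := Denom { dval : A; denomP : `[< ~ spec_set P dval >] }.
HB.instance Definition _ := [isSub for dval].
HB.instance Definition _ := [Choice of denom by <:].

Lemma denom1_subproof : `[< ~ spec_set P 1 >].
Proof. by apply/asboolP; case: (specP P) => -[]. Qed.

Lemma denomM_subproof (s t : denom) : `[< ~ spec_set P (dval s * dval t) >].
Proof.
apply/asboolP => /(specP P).2 [] H.
  by have /asboolP := denomP s.
by have /asboolP := denomP t.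
Qed.

Definition denom1 : denom := Denom denom1_subproof.
Definition denomM (s t : denom) : denom := Denom (denomM_subproof s t).

Definition frac_equiv (x y : A * denom) : Prop :=
  exists w : denom, dval w * (x.1 * dval y.2) = dval w * (y.1 * dval x.2).

Lemma frac_equiv_refl x : frac_equiv x x.
Proof. by exists denom1. Qed.

Lemma frac_equiv_sym x y : frac_equiv x y -> frac_equiv y x.
Proof. by case=> w e; exists w. Qed.

Lemma frac_equiv_trans y x z :
  frac_equiv x y -> frac_equiv y z -> frac_equiv x z.
Proof.
case: x y z => [a s] [b t] [c r] [w /= e1] [w' /= e2].
exists (denomM (denomM w w') t) => /=.
rewrite [LHS](_ : _ = (dval w * (a * dval t)) * (dval w' * dval r));
  last by ring.
rewrite e1 [LHS](_ : _ = (dval w' * (b * dval r)) * (dval w * dval s));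
  last by ring.
by rewrite e2; ring.
Qed.

Definition frac_equivb : rel (A * denom) := fun x y => `[< frac_equiv x y >].

Lemma frac_equivb_refl : reflexive frac_equivb.
Proof. by move=> x; apply/asboolP; apply: frac_equiv_refl. Qed.

Lemma frac_equivb_sym : symmetric frac_equivb.
Proof. by move=> x y; apply/asboolP/asboolP; apply: frac_equiv_sym. Qed.

Lemma frac_equivb_trans : transitive frac_equivb.
Proof.
by move=> y x z /asboolP xy /asboolP yz; apply/asboolP/(frac_equiv_trans xy yz).
Qed.

Canonical frac_equivb_equiv :=
  EquivRel frac_equivb frac_equivb_refl frac_equivb_sym frac_equivb_trans.

Definition localization := {eq_quot frac_equivb}.
HB.instance Definition _ : EqQuotient _ frac_equivb localization :=
  EqQuotient.on localization.
HB.instance Definition _ := Choice.on localization.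

Definition mkfrac (a : A) (s : denom) : localization := \pi_localization (a, s).

Lemma mkfracP a s b t : mkfrac a s = mkfrac b t <->
  exists w : denom, dval w * (a * dval t) = dval w * (b * dval s).
Proof.
split=> [H|H]; last by apply/eqmodP/asboolP.
exact/asboolP/(introT (@eqquotP _ _ localization (a, s) (b, t))).
Qed.

Lemma mkfracW (K : localization -> Prop) :
  (forall a s, K (mkfrac a s)) -> forall x, K x.
Proof. by move=> H; elim/quotW => -[a s]; apply: H. Qed.

Lemma repr_mkfrac a s : frac_equiv (repr (mkfrac a s)) (a, s).
Proof.
apply/asboolP/(introT (@eqquotP _ _ localization _ _)).
by rewrite reprK.
Qed.

Definition loc_add (x y : localization) : localization :=
  let: (a, s) := repr x in let: (b, t) := repr y in
  mkfrac (a * dval t + b * dval s) (denomM s t).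
Definition loc_opp (x : localization) : localization :=
  let: (a, s) := repr x in mkfrac (- a) s.
Definition loc_mul (x y : localization) : localization :=
  let: (a, s) := repr x in let: (b, t) := repr y in
  mkfrac (a * b) (denomM s t).

Lemma loc_addE a s b t :
  loc_add (mkfrac a s) (mkfrac b t) = mkfrac (a * dval t + b * dval s) (denomM s t).
Proof.
rewrite /loc_add; case: (repr _) (repr_mkfrac a s) => [a' s'] [w /= e].
case: (repr _) (repr_mkfrac b t) => [b' t'] [w' /= e'].
apply/mkfracP; exists (denomM w w') => /=.
rewrite [LHS](_ : _ = (dval w * (a' * dval s)) * (dval w' * dval t' * dval t)
  + (dval w' * (b' * dval t)) * (dval w * dval s' * dval s));
  last by ring.
by rewrite e e'; ring.
Qed.

Lemma loc_oppE a s : loc_opp (mkfrac a s) = mkfrac (- a) s.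
Proof.
rewrite /loc_opp; case: (repr _) (repr_mkfrac a s) => [a' s'] [w /= e].
by apply/mkfracP; exists w => /=; rewrite !mulNr !mulrN e.
Qed.

Lemma loc_mulE a s b t :
  loc_mul (mkfrac a s) (mkfrac b t) = mkfrac (a * b) (denomM s t).
Proof.
rewrite /loc_mul; case: (repr _) (repr_mkfrac a s) => [a' s'] [w /= e].
case: (repr _) (repr_mkfrac b t) => [b' t'] [w' /= e'].
apply/mkfracP; exists (denomM w w') => /=.
rewrite [LHS](_ : _ = (dval w * (a' * dval s)) * (dval w' * (b' * dval t)));
  last by ring.
by rewrite e e'; ring.
Qed.

Lemma loc_addA : associative loc_add.
Proof.
elim/mkfracW=> a s; elim/mkfracW=> b t; elim/mkfracW=> c r.
by rewrite !loc_addE; apply/mkfracP; exists denom1 => /=; ring.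
Qed.

Lemma loc_addC : commutative loc_add.
Proof.
elim/mkfracW=> a s; elim/mkfracW=> b t.
by rewrite !loc_addE; apply/mkfracP; exists denom1 => /=; ring.
Qed.

Lemma loc_add0 : left_id (mkfrac 0 denom1) loc_add.
Proof.
elim/mkfracW=> a s.
by rewrite !loc_addE; apply/mkfracP; exists denom1 => /=; ring.
Qed.

Lemma loc_addN : left_inverse (mkfrac 0 denom1) loc_opp loc_add.
Proof.
elim/mkfracW=> a s.
by rewrite loc_oppE loc_addE; apply/mkfracP; exists denom1 => /=; ring.
Qed.

HB.instance Definition _ :=
  GRing.isZmodule.Build localization loc_addA loc_addC loc_add0 loc_addN.

Lemma loc_mulA : associative loc_mul.
Proof.
elim/mkfracW=> a s; elim/mkfracW=> b t; elim/mkfracW=> c r.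
by rewrite !loc_mulE; apply/mkfracP; exists denom1 => /=; ring.
Qed.

Lemma loc_mulC : commutative loc_mul.
Proof.
elim/mkfracW=> a s; elim/mkfracW=> b t.
by rewrite !loc_mulE; apply/mkfracP; exists denom1 => /=; ring.
Qed.

Lemma loc_mul1 : left_id (mkfrac 1 denom1) loc_mul.
Proof.
elim/mkfracW=> a s.
by rewrite !loc_mulE; apply/mkfracP; exists denom1 => /=; ring.
Qed.

Lemma loc_mulDl : left_distributive loc_mul loc_add.
Proof.
elim/mkfracW=> a s; elim/mkfracW=> b t; elim/mkfracW=> c r.
rewrite loc_addE !loc_mulE loc_addE.
by apply/mkfracP; exists denom1 => /=; ring.
Qed.

Lemma loc_1_neq0 : mkfrac 1 denom1 != 0.
Proof.
apply/eqP => /mkfracP [w /=]; rewrite mul0r mul1r mulr0 mulr1 => w0.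
have /asboolP := denomP w; rewrite w0; apply.
by case: (specP P) => -[[]].
Qed.

HB.instance Definition _ := GRing.Zmodule_isComNzRing.Build localization
  loc_mulA loc_mulC loc_mul1 loc_mulDl loc_1_neq0.

Lemma mkfracD a s b t :
  mkfrac a s + mkfrac b t = mkfrac (a * dval t + b * dval s) (denomM s t).
Proof. exact: loc_addE. Qed.

Lemma mkfracN a s : - mkfrac a s = mkfrac (- a) s.
Proof. exact: loc_oppE. Qed.

Lemma mkfracM a s b t :
  mkfrac a s * mkfrac b t = mkfrac (a * b) (denomM s t).
Proof. exact: loc_mulE. Qed.

Definition to_loc (a : A) : localization := mkfrac a denom1.

Lemma to_loc_is_zmod_morphism : zmod_morphism to_loc.
Proof.
move=> a b; rewrite mkfracN mkfracD.
by apply/mkfracP; exists denom1 => /=; ring.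
Qed.

Lemma to_loc_is_monoid_morphism : monoid_morphism to_loc.
Proof.
split=> // a b; rewrite mkfracM.
by apply/mkfracP; exists denom1 => /=; ring.
Qed.

HB.instance Definition _ := GRing.isZmodMorphism.Build A localization to_loc
  to_loc_is_zmod_morphism.
HB.instance Definition _ := GRing.isMonoidMorphism.Build A localization to_loc
  to_loc_is_monoid_morphism.

Definition max_ideal : {pred localization} :=
  fun x => `[< ideal_gen (to_loc @` P) x >].

Lemma mem_max_ideal a s : (mkfrac a s \in max_ideal) <-> spec_set P a.
Proof.
have [[[P0 PD PM] _] Pprime] := specP P.
have PdN (w : denom) : ~ spec_set P (dval w) by apply/asboolP/denomP.
split=> [/asboolP H | Pa].
- pose J : set localization :=
    [set x | exists2 bt : A * denom, spec_set P bt.1 & x = mkfrac bt.1 bt.2].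
  have: J (mkfrac a s).
    apply: H => [|_ [b Pb <-]]; last by exists (b, denom1).
    split.
    + by exists (0, denom1).
    + move=> _ _ [[b t] /= Pb ->] [[c r] /= Pc ->].
      exists (b * dval r + c * dval t, denomM t r); last by rewrite mkfracD.
      by rewrite /= mulrC [c * _]mulrC; apply: (PD); apply: (PM).
    + elim/mkfracW => c r _ [[b t] /= Pb ->].
      by exists (c * b, denomM r t); [apply: (PM) | rewrite mkfracM].
  case=> -[b t] /= Pb /mkfracP [w e].
  have : spec_set P (dval w * (a * dval t)).
    by rewrite e mulrCA mulrC; apply: (PM).
  by case/Pprime => [/PdN //|/Pprime [//|/PdN]].
- apply/asboolP.
  have -> : mkfrac a s = mkfrac 1 s * to_loc a.
    by rewrite mkfracM; apply/mkfracP; exists denom1 => /=; ring.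
  have [_ _] := ideal_gen_is_ideal (to_loc @` P); apply.
  by apply: sub_ideal_gen; exists a.
Qed.

Lemma max_ideal_is_idealr : idealr_closed max_ideal.
Proof.
have [I0 ID IM] := ideal_gen_is_ideal (to_loc @` P).
split; first by apply/asboolP.
- by apply/negP => /mem_max_ideal; case: (specP P) => -[].
- move=> a x y /asboolP Ix /asboolP Iy; apply/asboolP.
  by apply: ID => //; apply: IM.
Qed.

HB.instance Definition _ :=
  isIdealr.Build localization max_ideal max_ideal_is_idealr.

Definition residue_field := {ideal_quot max_ideal}.
HB.instance Definition _ := GRing.ComNzRing.on residue_field.

Definition loc_residue (x : localization) : residue_field :=
  \pi_residue_field x.

Lemma loc_residue_eq x y :
  loc_residue x = loc_residue y <-> x - y \in max_ideal.
Proof. by rewrite Quotient.idealrBE; split=> [/eqP|/eqP]. Qed.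

Lemma loc_residue_is_zmod_morphism : zmod_morphism loc_residue.
Proof. exact: raddfB. Qed.

Lemma loc_residue_is_monoid_morphism : monoid_morphism loc_residue.
Proof. by split; [exact: rmorph1 | exact: rmorphM]. Qed.

HB.instance Definition _ := GRing.isZmodMorphism.Build
  localization residue_field loc_residue loc_residue_is_zmod_morphism.
HB.instance Definition _ := GRing.isMonoidMorphism.Build
  localization residue_field loc_residue loc_residue_is_monoid_morphism.

Lemma loc_residueW (K : residue_field -> Prop) :
  (forall x, K (loc_residue x)) -> forall x, K x.
Proof. by move=> H; elim/quotW => x; apply: H. Qed.

Definition residue_inv (x : residue_field) : residue_field :=
  xget 0 [set y | y * x = 1].

Lemma residue_mulV x : x != 0 -> residue_inv x * x = 1.
Proof.
move=> xN0; suff : exists y, y * x = 1 by move/(xgetPex 0).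
elim/loc_residueW: x xN0; elim/mkfracW => a s xN0.
have aNP : `[< ~ spec_set P a >].
  apply/asboolP => /(mem_max_ideal a s) as0.
  move/eqP: xN0; apply; rewrite -(raddf0 loc_residue).
  by apply/loc_residue_eq; rewrite subr0.
exists (loc_residue (mkfrac (dval s) (Denom aNP))).
rewrite -rmorphM mkfracM -(rmorph1 loc_residue); congr loc_residue.
by apply/mkfracP; exists denom1 => /=; ring.
Qed.

Lemma residue_inv0 : residue_inv 0 = 0.
Proof.
rewrite /residue_inv; case: xgetP => // y _ /=; rewrite mulr0 => /esym/eqP.
by rewrite oner_eq0.
Qed.

HB.instance Definition _ :=
  GRing.ComNzRing_isField.Build residue_field residue_mulV residue_inv0.

Definition to_residue : A -> residue_field := loc_residue \o to_loc.
HB.instance Definition _ := GRing.RMorphism.on to_residue.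

End Localization.

Arguments max_ideal {A} P _.

(* a/s |-> u(a)/u(s), then its reduction modulo the maximal ideals. *)
Section ResidueMap.
Variables (A B : comPzRingType) (u : {rmorphism A -> B}) (Q : spec B).
Local Notation P := (spec_preimage u Q).

Lemma denom_map_subproof (s : denom P) : `[< ~ spec_set Q (u (dval s)) >].
Proof. by have /asboolP H := denomP s; apply/asboolP. Qed.

Definition denom_map (s : denom P) : denom Q := Denom (denom_map_subproof s).

Definition loc_map (x : localization P) : localization Q :=
  let: (a, s) := repr x in mkfrac (u a) (denom_map s).

Lemma loc_mapE a s : loc_map (mkfrac a s) = mkfrac (u a) (denom_map s).
Proof.
rewrite /loc_map; case: (repr _) (repr_mkfrac a s) => [a' s'] [w /= e].
by apply/mkfracP; exists (denom_map w); rewrite /= -!rmorphM e.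
Qed.

Lemma loc_map_is_zmod_morphism : zmod_morphism loc_map.
Proof.
elim/mkfracW=> a s; elim/mkfracW=> b t.
rewrite mkfracN mkfracD !loc_mapE mkfracN mkfracD.
by apply/mkfracP; exists (denom1 Q); rewrite /= rmorphD !rmorphM rmorphN.
Qed.

Lemma loc_map_is_monoid_morphism : monoid_morphism loc_map.
Proof.
split=> [|x y].
  rewrite -[1]/(mkfrac 1 (denom1 P)) loc_mapE.
  by apply/mkfracP; exists (denom1 Q); rewrite /= !rmorph1.
elim/mkfracW: x => a s; elim/mkfracW: y => b t.
rewrite mkfracM !loc_mapE mkfracM.
by apply/mkfracP; exists (denom1 Q); rewrite /= !rmorphM.
Qed.

HB.instance Definition _ := GRing.isZmodMorphism.Build
  (localization P) (localization Q) loc_map loc_map_is_zmod_morphism.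
HB.instance Definition _ := GRing.isMonoidMorphism.Build
  (localization P) (localization Q) loc_map loc_map_is_monoid_morphism.

Lemma loc_map_max x : x \in max_ideal P -> loc_map x \in max_ideal Q.
Proof.
elim/mkfracW: x => a s /mem_max_ideal Pa.
by rewrite loc_mapE; apply/mem_max_ideal.
Qed.

Definition residue_map (x : residue_field P) : residue_field Q :=
  loc_residue (loc_map (repr x)).

Lemma residue_mapE x : residue_map (loc_residue x) = loc_residue (loc_map x).
Proof.
apply/loc_residue_eq; rewrite -raddfB; apply: loc_map_max.
by apply/loc_residue_eq; rewrite /loc_residue reprK.
Qed.

Lemma residue_map_is_zmod_morphism : zmod_morphism residue_map.
Proof.
elim/loc_residueW=> x; elim/loc_residueW=> y.
by rewrite -raddfB !residue_mapE !raddfB.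
Qed.

Lemma residue_map_is_monoid_morphism : monoid_morphism residue_map.
Proof.
split=> [|x y].
  by rewrite -(rmorph1 (@loc_residue _ P)) residue_mapE !rmorph1.
elim/loc_residueW: x => x; elim/loc_residueW: y => y.
by rewrite -rmorphM !residue_mapE !rmorphM.
Qed.

HB.instance Definition _ := GRing.isZmodMorphism.Build
  (residue_field P) (residue_field Q) residue_map residue_map_is_zmod_morphism.
HB.instance Definition _ := GRing.isMonoidMorphism.Build
  (residue_field P) (residue_field Q) residue_map residue_map_is_monoid_morphism.

Lemma residue_map_to_residue a :
  residue_map (to_residue P a) = to_residue Q (u a).
Proof.
rewrite residue_mapE loc_mapE; congr loc_residue.
by apply/mkfracP; exists (denom1 Q); rewrite /= !rmorph1.
Qed.

End ResidueMap.

Arguments loc_map {A B} u Q _.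
Arguments residue_map {A B} u Q _.

(* C \otimes_A B as formal sums of pure tensors (c, b), modulo bilinearity and *)
(* A-balancedness. Opposites exist since (-c, b) + (c, b) = (0, b) = 0.        *)
Section Tensor.
Variables (A C B : comPzRingType).
Variables (f : {rmorphism A -> C}) (u : {rmorphism A -> B}).
Local Notation fsum := (seq (C * B)).
Implicit Types s t r : fsum.

Inductive tensor_equiv : fsum -> fsum -> Prop :=
| tensor_refl s : tensor_equiv s s
| tensor_sym s t : tensor_equiv s t -> tensor_equiv t s
| tensor_trans s t r : tensor_equiv s t -> tensor_equiv t r -> tensor_equiv s r
| tensor_cat s s' t t' :
    tensor_equiv s s' -> tensor_equiv t t' -> tensor_equiv (s ++ t) (s' ++ t')
| tensor_catC s t : tensor_equiv (s ++ t) (t ++ s)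
| tensor_Dl c c' b : tensor_equiv [:: (c + c', b)] [:: (c, b); (c', b)]
| tensor_Dr c b b' : tensor_equiv [:: (c, b + b')] [:: (c, b); (c, b')]
| tensor_bal a c b : tensor_equiv [:: (f a * c, b)] [:: (c, u a * b)]
| tensor_0l b : tensor_equiv [:: (0, b)] [::].

Definition tensor_equivb : rel fsum := fun s t => `[< tensor_equiv s t >].

Lemma tensor_equivb_refl : reflexive tensor_equivb.
Proof. by move=> s; apply/asboolP; apply: tensor_refl. Qed.

Lemma tensor_equivb_sym : symmetric tensor_equivb.
Proof. by move=> s t; apply/asboolP/asboolP; apply: tensor_sym. Qed.

Lemma tensor_equivb_trans : transitive tensor_equivb.
Proof.
by move=> t s r /asboolP st /asboolP tr; apply/asboolP/(tensor_trans st tr).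
Qed.

Canonical tensor_equivb_equiv := EquivRel tensor_equivb
  tensor_equivb_refl tensor_equivb_sym tensor_equivb_trans.

Definition tensor := {eq_quot tensor_equivb}.
HB.instance Definition _ : EqQuotient _ tensor_equivb tensor :=
  EqQuotient.on tensor.
HB.instance Definition _ := Choice.on tensor.

Definition tclass s : tensor := \pi_tensor s.

Lemma tclassP s t : tclass s = tclass t <-> tensor_equiv s t.
Proof.
split=> [H|H]; last exact/(elimT (@eqquotP _ _ tensor s t))/asboolP.
exact/asboolP/(introT (@eqquotP _ _ tensor s t)).
Qed.

Lemma tclassW (K : tensor -> Prop) : (forall s, K (tclass s)) -> forall x, K x.
Proof. by move=> H; elim/quotW => s; apply: H. Qed.

Lemma repr_tclass s : tensor_equiv (repr (tclass s)) s.
Proof. by apply/tclassP; rewrite /tclass reprK. Qed.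

Definition pmul (x y : C * B) : C * B := (x.1 * y.1, x.2 * y.2).
Definition fopp s : fsum := [seq (- x.1, x.2) | x <- s].
Definition fmul s t : fsum := [seq pmul x y | x <- s, y <- t].

Lemma pmulC x y : pmul x y = pmul y x.
Proof. by rewrite /pmul mulrC [x.2 * _]mulrC. Qed.

Lemma pmulA x y z : pmul x (pmul y z) = pmul (pmul x y) z.
Proof. by rewrite /pmul /= !mulrA. Qed.

Lemma fopp_equiv s t : tensor_equiv s t -> tensor_equiv (fopp s) (fopp t).
Proof.
elim=> {s t} [s|s t _|s t r _ st _ tr|s s' t t' _ ss' _ tt'|s t|c c' b|c b b'
  |a c b|b] /=.
- exact: tensor_refl.
- exact: tensor_sym.
- exact: tensor_trans st tr.
- by rewrite /fopp !map_cat; apply: tensor_cat.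
- by rewrite /fopp !map_cat; apply: tensor_catC.
- by rewrite opprD; apply: tensor_Dl.
- exact: tensor_Dr.
- by rewrite -mulrN; apply: tensor_bal.
- by rewrite oppr0; apply: tensor_0l.
Qed.

Lemma map_pmul_equiv x s t : tensor_equiv s t ->
  tensor_equiv (map (pmul x) s) (map (pmul x) t).
Proof.
elim=> {s t} [s|s t _|s t r _ st _ tr|s s' t t' _ ss' _ tt'|s t|c c' b|c b b'
  |a c b|b] /=.
- exact: tensor_refl.
- exact: tensor_sym.
- exact: tensor_trans st tr.
- by rewrite !map_cat; apply: tensor_cat.
- by rewrite !map_cat; apply: tensor_catC.
- by rewrite /pmul /= mulrDr; apply: tensor_Dl.
- by rewrite /pmul /= mulrDr; apply: tensor_Dr.
- by rewrite /pmul /= mulrCA [_ * (u a * b)]mulrCA; apply: tensor_bal.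
- by rewrite /pmul /= mulr0; apply: tensor_0l.
Qed.

Lemma tensor_cons x s t :
  tensor_equiv s t -> tensor_equiv (x :: s) (x :: t).
Proof. by move=> st; apply: (tensor_cat (tensor_refl [:: x]) st). Qed.

Lemma fmul_consl x s t : fmul (x :: s) t = map (pmul x) t ++ fmul s t.
Proof. by []. Qed.

Lemma fmul_catl s s' t : fmul (s ++ s') t = fmul s t ++ fmul s' t.
Proof. exact: allpairs_cat. Qed.

Lemma fmul_equivr s t t' : tensor_equiv t t' ->
  tensor_equiv (fmul s t) (fmul s t').
Proof.
move=> tt'; elim: s => [|x s IH]; first exact: tensor_refl.
by rewrite !fmul_consl; apply: tensor_cat => //; apply: map_pmul_equiv.
Qed.

Lemma perm_tensor_equiv s t : perm_eq s t -> tensor_equiv s t.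
Proof.
elim: s t => [|x s IH] t.
  by move/perm_size/esym/size0nil ->; apply: tensor_refl.
move=> st; have xt : x \in t by rewrite -(perm_mem st) mem_head.
case/splitPr: xt st => t1 t2; rewrite perm_sym -[x :: t2]cat1s.
rewrite perm_catCA /= perm_cons perm_sym => /IH H.
apply: tensor_trans (tensor_cons x H) _.
apply: tensor_trans (tensor_catC [:: x] (t1 ++ t2)) _.
rewrite -catA; apply: tensor_cat (tensor_refl _) _.
exact: tensor_catC.
Qed.

Lemma fmulC s t : tensor_equiv (fmul s t) (fmul t s).
Proof.
elim: s => [|x s IH].
  by rewrite /fmul allpairs0r; apply: tensor_refl.
rewrite fmul_consl; apply: tensor_trans (tensor_cat (tensor_refl _) IH) _.
apply/tensor_sym/perm_tensor_equiv.
rewrite /fmul (perm_allpairs_consr _ _ (fun=> x) (fun=> s)).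
by rewrite (eq_map (pmulC^~ x)).
Qed.

Lemma fmul_equiv s s' t t' : tensor_equiv s s' -> tensor_equiv t t' ->
  tensor_equiv (fmul s t) (fmul s' t').
Proof.
move=> ss' tt'; apply: tensor_trans (fmul_equivr _ tt') _.
apply: tensor_trans (fmulC _ _) _; apply: tensor_trans (fmulC _ _).
exact: fmul_equivr.
Qed.

Lemma fmulA s t r : fmul s (fmul t r) = fmul (fmul s t) r.
Proof.
elim: s => [//|x s IH]; rewrite !fmul_consl fmul_catl -IH; congr (_ ++ _).
elim: t {IH} => [//|y t IH]; rewrite /= !fmul_consl map_cat IH; congr (_ ++ _).
by rewrite -map_comp; apply: eq_map => z /=; rewrite pmulA.
Qed.

Definition tens_add (x y : tensor) : tensor := tclass (repr x ++ repr y).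
Definition tens_opp (x : tensor) : tensor := tclass (fopp (repr x)).
Definition tens_mul (x y : tensor) : tensor := tclass (fmul (repr x) (repr y)).

Lemma tens_addE s t : tens_add (tclass s) (tclass t) = tclass (s ++ t).
Proof. by apply/tclassP; apply: tensor_cat; apply: repr_tclass. Qed.

Lemma tens_oppE s : tens_opp (tclass s) = tclass (fopp s).
Proof. by apply/tclassP; apply: fopp_equiv; apply: repr_tclass. Qed.

Lemma tens_mulE s t : tens_mul (tclass s) (tclass t) = tclass (fmul s t).
Proof. by apply/tclassP; apply: fmul_equiv; apply: repr_tclass. Qed.

Lemma tens_addA : associative tens_add.
Proof.
elim/tclassW=> s; elim/tclassW=> t; elim/tclassW=> r.
by rewrite !tens_addE catA.
Qed.

Lemma tens_addC : commutative tens_add.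
Proof.
elim/tclassW=> s; elim/tclassW=> t.
by rewrite !tens_addE; apply/tclassP/tensor_catC.
Qed.

Lemma tens_add0 : left_id (tclass [::]) tens_add.
Proof. by elim/tclassW=> s; rewrite tens_addE. Qed.

Lemma tens_addN : left_inverse (tclass [::]) tens_opp tens_add.
Proof.
elim/tclassW=> s; rewrite tens_oppE tens_addE; apply/tclassP.
elim: s => [|[c b] s IH]; first exact: tensor_refl.
apply: (@tensor_trans _ ([:: (- c, b); (c, b)] ++ (fopp s ++ s))).
  apply: perm_tensor_equiv; rewrite /= perm_cons -cat1s.
  by rewrite perm_catCA.
rewrite -[X in tensor_equiv _ X]/([::] ++ [::]); apply: tensor_cat IH.
apply: tensor_trans (tensor_sym (tensor_Dl _ _ _)) _.
by rewrite addNr; apply: tensor_0l.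
Qed.

HB.instance Definition _ :=
  GRing.isZmodule.Build tensor tens_addA tens_addC tens_add0 tens_addN.

Lemma tens_mulA : associative tens_mul.
Proof.
elim/tclassW=> s; elim/tclassW=> t; elim/tclassW=> r.
by rewrite !tens_mulE fmulA.
Qed.

Lemma tens_mulC : commutative tens_mul.
Proof.
elim/tclassW=> s; elim/tclassW=> t.
by rewrite !tens_mulE; apply/tclassP/fmulC.
Qed.

Lemma tens_mul1 : left_id (tclass [:: (1, 1)]) tens_mul.
Proof.
elim/tclassW=> s; rewrite tens_mulE fmul_consl cats0; congr tclass.
by rewrite -[RHS]map_id; apply: eq_map => -[c b]; rewrite /pmul /= !mul1r.
Qed.

Lemma tens_mulDl : left_distributive tens_mul tens_add.
Proof.
elim/tclassW=> s; elim/tclassW=> t; elim/tclassW=> r.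
by rewrite tens_addE !tens_mulE tens_addE fmul_catl.
Qed.

HB.instance Definition _ := GRing.Zmodule_isComPzRing.Build tensor
  tens_mulA tens_mulC tens_mul1 tens_mulDl.

Definition pure_tensor (c : C) (b : B) : tensor := tclass [:: (c, b)].
Local Notation "c ⊗ b" := (pure_tensor c b) (at level 40).

Lemma tclassE s : tclass s = \sum_(x <- s) x.1 ⊗ x.2.
Proof.
elim: s => [|[c b] s IH]; first by rewrite big_nil.
by rewrite big_cons -IH -[RHS]/(tens_add _ _) tens_addE.
Qed.

Lemma pure_tensorDl c c' b : (c + c') ⊗ b = c ⊗ b + c' ⊗ b.
Proof. by rewrite -[RHS]/(tens_add _ _) tens_addE; apply/tclassP/tensor_Dl. Qed.

Lemma pure_tensorDr c b b' : c ⊗ (b + b') = c ⊗ b + c ⊗ b'.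
Proof. by rewrite -[RHS]/(tens_add _ _) tens_addE; apply/tclassP/tensor_Dr. Qed.

Lemma pure_tensor_bal a c b : (f a * c) ⊗ b = c ⊗ (u a * b).
Proof. exact/tclassP/tensor_bal. Qed.

Lemma pure_tensor0l b : 0 ⊗ b = 0.
Proof. exact/tclassP/tensor_0l. Qed.

Lemma pure_tensorNl c b : (- c) ⊗ b = - (c ⊗ b).
Proof. by rewrite -[RHS]/(tens_opp _) tens_oppE. Qed.

Lemma pure_tensorM c c' b b' : (c ⊗ b) * (c' ⊗ b') = (c * c') ⊗ (b * b').
Proof. by rewrite -[LHS]/(tens_mul _ _) tens_mulE. Qed.

Definition tensor_inl (c : C) : tensor := c ⊗ 1.

Lemma tensor_inl_is_zmod_morphism : zmod_morphism tensor_inl.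
Proof. by move=> c c'; rewrite /tensor_inl pure_tensorDl pure_tensorNl. Qed.

Lemma tensor_inl_is_monoid_morphism : monoid_morphism tensor_inl.
Proof. by split=> // c c'; rewrite /tensor_inl pure_tensorM mulr1. Qed.

HB.instance Definition _ := GRing.isZmodMorphism.Build C tensor tensor_inl
  tensor_inl_is_zmod_morphism.
HB.instance Definition _ := GRing.isMonoidMorphism.Build C tensor tensor_inl
  tensor_inl_is_monoid_morphism.

Definition tensor_scale (c : C) (x : tensor) : tensor := tensor_inl c * x.

Lemma tensor_scaleA c c' x :
  tensor_scale c (tensor_scale c' x) = tensor_scale (c * c') x.
Proof. by rewrite /tensor_scale rmorphM mulrA. Qed.

Lemma tensor_scale1 : left_id 1 tensor_scale.
Proof. by move=> x; rewrite /tensor_scale rmorph1 mul1r. Qed.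

Lemma tensor_scaleDr : right_distributive tensor_scale +%R.
Proof. by move=> c x y; rewrite /tensor_scale mulrDr. Qed.

Lemma tensor_scaleDl x : {morph tensor_scale^~ x : c c' / c + c'}.
Proof. by move=> c c'; rewrite /tensor_scale raddfD mulrDl. Qed.

HB.instance Definition _ := GRing.Zmodule_isLmodule.Build C tensor
  tensor_scaleA tensor_scale1 tensor_scaleDr tensor_scaleDl.

Lemma scale_pure_tensor c c' b : c *: (c' ⊗ b) = (c * c') ⊗ b.
Proof. by rewrite -[LHS]/(_ ⊗ 1 * _) pure_tensorM mul1r. Qed.

Lemma tensor_univ (M : zmodType) (h : C -> B -> M) :
    (forall c c' b, h (c + c') b = h c b + h c' b) ->
    (forall c b b', h c (b + b') = h c b + h c b') ->
    (forall a c b, h (f a * c) b = h c (u a * b)) ->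
  exists2 g : tensor -> M, zmod_morphism g & forall c b, g (c ⊗ b) = h c b.
Proof.
move=> hDl hDr hbal; pose H s := \sum_(x <- s) h x.1 x.2.
have h0 b : h 0 b = 0 by apply: (addrI (h 0 b)); rewrite -hDl !addr0.
have hN c b : h (- c) b = - h c b.
  by apply: (addrI (h c b)); rewrite -hDl !subrr h0.
have HP s t : tensor_equiv s t -> H s = H t.
  elim=> {s t} [s|s t _|s t r _ -> _ ->|s s' t t' _ ss' _ tt'|s t|c c' b|c b b'
    |a c b|b] //; rewrite /H ?big_cat ?big_cons ?big_nil /= ?addr0 //.
  - by rewrite /H in ss' tt'; rewrite ss' tt'.
  - exact: addrC.
have HE s : H (repr (tclass s)) = H s by apply: HP; apply: repr_tclass.
exists (fun x => H (repr x)) => [|c b]; last by rewrite HE /H big_seq1.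
elim/tclassW=> s; elim/tclassW=> t.
rewrite -[tclass s - _]/(tens_add _ (tens_opp _)) tens_oppE tens_addE !HE.
rewrite /H big_cat big_map /= -sumrN; congr (_ + _).
by apply: eq_bigr => x _; rewrite hN.
Qed.

End Tensor.

Definition is_Aprime_ideal (A B : comPzRingType) (u : {rmorphism A -> B})
    (I : set B) : Prop :=
  is_proper_ideal I /\ forall a b, I (u a * b) -> I (u a) \/ I b.

Definition PSI_morphism (A B : comPzRingType) (u : {rmorphism A -> B}) : Prop :=
  forall I : set B, is_Aprime_ideal u I -> is_prime_ideal I.

Notation fiber u P := (tensor (to_residue P) u).

Definition to_fiber (A B : comPzRingType) (u : {rmorphism A -> B}) (P : spec A) :
  {rmorphism residue_field P -> fiber u P} := tensor_inl (to_residue P) u.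

Definition strong_PSI_morphism (A B : comPzRingType) (u : {rmorphism A -> B}) :
    Prop :=
  forall P : spec A,
    (exists x : fiber u P, x != 0) -> bijective (to_fiber u P).

(* [Vector.axiom d V] is a linear isomorphism V -> 'rV[K]_d. *)
Definition dim_le (K : fieldType) (V : lmodType K) (n : nat) : Prop :=
  exists2 d, (d <= n)%N & inhabited (Vector.axiom d V).

(* Main.v *)
From HB Require Import structures.
Require Import Defs.
From mathcomp Require Import all_boot all_algebra.
From mathcomp Require Import ring boolp classical_sets.

(** Everything goes through one condition: for every prime P of A, the map
    k(P) -> k(P) ⊗ B is surjective. A map out of a field into a nonzero ring is
    injective, so this is the strong PSI property ([strong_PSI_fiberP]); its
    image is the line spanned by 1, so it is also the bound on dimensions
    ([fiber_dim_le1P]).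

    Suppose these maps are surjective and let I be an A-prime ideal of B, lying
    over the prime P of A. Since 1 ⊗ b is of the form (a/s) ⊗ 1, the element
    u(s)b - u(a) dies in the fiber at P. The fiber maps to the localization of
    B/I at A \ P, and B/I embeds there because I is A-prime; so u(s)b - u(a)
    is in I ([tensor_inr_eq0]). Thus every b is congruent to a fraction a/s
    modulo I ([generically_onto]). A-primality, which controls products with one
    factor from A, then controls all products and I is prime
    ([PSI_of_generically_onto]); for a prime Q of B, the same congruences say
    that every element of B has its residue in the image of k(P) -> k(Q), which
    is then onto ([generically_onto_residue_bij]).

    Conversely, assume that u is PSI with isomorphic residue fields. If the fiber
    at P is nonzero, then the kernel Q of B -> k(P) ⊗ B is A-prime over P, hence
    prime, and surjectivity of k(P) -> k(Q) gives for each b a congruence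
    modulo Q of b with a fraction a/s. Reading it in the fiber gives
    1 ⊗ b = (a/s) ⊗ 1 ([fiber_surj_of_residue_bij]). *)

Set Implicit Arguments.
Unset Strict Implicit.
Unset Printing Implicit Defensive.

Import GRing.Theory.
Local Open Scope ring_scope.

(** * Residue fields *)

Lemma inj_surj_bijective (T U : Type) (f : T -> U) :
  injective f -> (forall y, exists x, f x = y) -> bijective f.
Proof.
move=> f_inj /choice[g gK]; exists g => // x.
by apply: f_inj; rewrite gK.
Qed.

Section ResidueField.
Variables (A : comPzRingType) (P : spec A).

Lemma to_residue_eq0 a : to_residue P a = 0 <-> spec_set P a.
Proof.
rewrite -(raddf0 (@loc_residue A P)); split.
  by move/loc_residue_eq; rewrite subr0 => /mem_max_ideal.
by move=> Pa; apply/loc_residue_eq; rewrite subr0; apply/mem_max_ideal.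
Qed.

Lemma to_residue_eq a b :
  to_residue P a = to_residue P b <-> spec_set P (a - b).
Proof.
rewrite -to_residue_eq0 rmorphB /=; split=> [e|/eqP]; first by rewrite e subrr.
by rewrite subr_eq0 => /eqP.
Qed.

Lemma to_residue_neq0 a : ~ spec_set P a -> to_residue P a != 0.
Proof. by move=> nPa; apply/eqP => /to_residue_eq0. Qed.

Lemma residue_fieldP (c : residue_field P) :
  exists a s, ~ spec_set P s /\ c = to_residue P a / to_residue P s.
Proof.
elim/loc_residueW: c; elim/mkfracW => a s.
have /asboolP nPs := denomP s.
exists a, (dval s); split=> //.
apply: (canRL (mulfK (to_residue_neq0 nPs))).
rewrite -[to_residue P _]/(loc_residue _) -rmorphM mkfracM.
congr loc_residue; apply/mkfracP; exists (denom1 P) => /=; ring.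
Qed.

End ResidueField.

Section IdealOperations.
Variables (R : comPzRingType) (I : set R).
Hypothesis idI : is_ideal I.

Lemma ideal0 : I 0. Proof. by case: idI. Qed.
Lemma idealD x y : I x -> I y -> I (x + y).
Proof. by case: idI => _ + _; apply. Qed.
Lemma idealMl a x : I x -> I (a * x).
Proof. by case: idI => _ _; apply. Qed.
Lemma idealMr a x : I x -> I (x * a).
Proof. by rewrite mulrC; apply: idealMl. Qed.
Lemma idealN x : I x -> I (- x).
Proof. by rewrite -mulN1r; apply: idealMl. Qed.
Lemma idealB x y : I x -> I y -> I (x - y).
Proof. by move=> Ix Iy; apply: idealD => //; apply: idealN. Qed.

End IdealOperations.

(** * The fiber ring *)

Section SecondFactor.
Variables (A C B : comPzRingType).
Variables (f : {rmorphism A -> C}) (u : {rmorphism A -> B}).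

Definition tensor_inr (b : B) : tensor f u := pure_tensor f u 1 b.

Lemma tensor_inr_is_zmod_morphism : zmod_morphism tensor_inr.
Proof.
move=> b b'; apply: (addIr (tensor_inr b')).
by rewrite addrNK -pure_tensorDr addrNK.
Qed.

Lemma tensor_inr_is_monoid_morphism : monoid_morphism tensor_inr.
Proof. by split=> // b b'; rewrite /tensor_inr pure_tensorM mulr1. Qed.

HB.instance Definition _ := GRing.isZmodMorphism.Build B (tensor f u)
  tensor_inr tensor_inr_is_zmod_morphism.
HB.instance Definition _ := GRing.isMonoidMorphism.Build B (tensor f u)
  tensor_inr tensor_inr_is_monoid_morphism.

Lemma pure_tensorE c b :
  pure_tensor f u c b = tensor_inl f u c * tensor_inr b.
Proof. by rewrite pure_tensorM mulr1 mul1r. Qed.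

Lemma tensor_inr_base a : tensor_inr (u a) = tensor_inl f u (f a).
Proof. by rewrite /tensor_inr -[u a]mulr1 -pure_tensor_bal mulr1. Qed.

End SecondFactor.

Section Fiber.
Variables (A B : comPzRingType) (u : {rmorphism A -> B}) (P : spec A).
Local Notation rho := (to_residue P).
Local Notation iota := (to_fiber u P).
Local Notation inr := (tensor_inr rho u).

Let inrM : {morph inr : x y / x * y}. Proof. exact: rmorphM. Qed.
Let inrB : {morph inr : x y / x - y}. Proof. exact: rmorphB. Qed.

Lemma fiber_inr_base a : inr (u a) = iota (rho a).
Proof. exact: tensor_inr_base. Qed.

Lemma to_fiber_unit c : c != 0 -> iota c * iota c^-1 = 1.
Proof. by move=> c0; rewrite -rmorphM mulfV // rmorph1. Qed.

(** Clearing denominators turns the equation 1 ⊗ b = (a/s) ⊗ 1 in the fiber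
    into the membership of u(s)b - u(a) in the kernel of B -> fiber, since s
    is invertible in the residue field. *)
Lemma inr_fracP a s b : ~ spec_set P s ->
  inr b = iota (rho a / rho s) <-> inr (u s * b - u a) = 0.
Proof.
move=> /to_residue_neq0 s0.
rewrite inrB inrM !fiber_inr_base (rmorphM iota).
split=> [->|/eqP]; first by rewrite mulrCA to_fiber_unit // mulr1 subrr.
rewrite subr_eq0 => /eqP <-.
by rewrite mulrAC to_fiber_unit // mul1r.
Qed.

Lemma fiber_trivial : (1 : fiber u P) = 0 -> forall x : fiber u P, x = 0.
Proof. by move=> e x; rewrite -[x]mul1r e mul0r. Qed.

Lemma to_fiber_inj : (1 : fiber u P) <> 0 -> injective iota.
Proof.
move=> ntF; apply: raddf_inj => c ic0; apply/eqP/negP => /negP/to_fiber_unit.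
by rewrite ic0 mul0r => /esym.
Qed.

Lemma fiber_contr a : (1 : fiber u P) <> 0 ->
  inr (u a) = 0 <-> spec_set P a.
Proof.
move=> ntF; rewrite fiber_inr_base -to_residue_eq0 -(rmorph0 iota).
by split=> [/(to_fiber_inj ntF)|->].
Qed.

(** Elements of A outside P become units of the fiber, so a factor u(a)
    with a outside P can be cancelled from a product in the kernel of
    B -> fiber. The PSI hypothesis gets applied to this ideal, which contracts
    to P by [fiber_contr]. *)
Lemma fiber_kernel_Aprime : (1 : fiber u P) <> 0 ->
  is_Aprime_ideal u [set b | inr b = 0].
Proof.
move=> ntF; split; first split; [split| |] => /=.
- exact: rmorph0.
- by move=> x y x0 y0; rewrite rmorphD /= x0 y0 addr0.
- by move=> a x x0; rewrite rmorphM /= x0 mulr0.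
- by rewrite rmorph1.
move=> a b ab0; case: (pselect (spec_set P a)) => [|/to_residue_neq0 a0].
  by left; apply/fiber_contr.
right; rewrite -[LHS]mul1r -(to_fiber_unit a0) mulrAC -fiber_inr_base.
by rewrite -inrM ab0 mul0r.
Qed.

(** The fiber is spanned over the residue field by the image of B. *)
Lemma to_fiber_surj :
  (forall b, exists c, iota c = inr b) -> forall x, exists c, iota c = x.
Proof.
move=> inr_im; elim/tclassW=> s; rewrite tclassE.
elim: s => [|[c b] s [c' e]]; first by exists 0; rewrite big_nil rmorph0.
have [c'' eb] := inr_im b; exists (c * c'' + c').
by rewrite big_cons -e pure_tensorE -eb rmorphD rmorphM.
Qed.

(** The fiber has a distinguished vector, its unit, and [to_fiber] spans the
    line through it; a nonzero fiber has dimension at most 1 exactly when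
    this line is everything. *)
Lemma fiber_dim_le1P :
  dim_le (fiber u P) 1 <-> forall x, exists c, iota c = x.
Proof.
split=> [[d dle [[v2r v2r_lin /bij_inj v2r_inj]]] x|iota_surj].
  have [e|ntF] := pselect ((1 : fiber u P) = 0).
    by exists 0; rewrite rmorph0 (fiber_trivial e x).
  have v2rZ : scalable v2r := GRing.scalable_linear v2r_lin.
  case: d dle v2r {v2r_lin} v2r_inj v2rZ => [|[|//]] _ v2r v2r_inj v2rZ.
    by case: ntF; apply: v2r_inj; rewrite !thinmx0.
  have v10 : v2r 1 0 0 != 0.
    apply/eqP => v10; apply: ntF; apply: v2r_inj.
    rewrite -[RHS]/(v2r 0) -[X in _ = v2r X](scale0r (1 : fiber u P)) v2rZ.
    by apply/matrixP => i j; rewrite mxE !ord1 v10 mulr0.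
  (* The scalar is forced: x = c *: 1 compares the coordinates of x and 1. *)
  exists (v2r x 0 0 / v2r 1 0 0); rewrite -[LHS]mulr1.
  apply: v2r_inj; rewrite [LHS]v2rZ; apply/matrixP => i j.
  by rewrite !mxE !ord1 divfK.
have [e|ntF] := pselect ((1 : fiber u P) = 0).
  exists 0%N => //; split; exists (fun=> 0).
    by move=> c x y; rewrite scaler0 addr0.
  by exists (fun=> 0) => [x|x]; rewrite ?thinmx0 // (fiber_trivial e x).
exists 1%N => //; split.
have iinj := to_fiber_inj ntF.
have [g gK] := choice iota_surj.
exists (fun x => const_mx (g x)).
  move=> c x y; apply/matrixP=> i j; rewrite !mxE; apply: iinj.
  by rewrite rmorphD rmorphM !gK.
exists (fun v : 'rV_1 => iota (v 0 0)) => [x|v]; first by rewrite mxE gK.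
by apply/matrixP=> i j; rewrite !mxE !ord1; apply: iinj; rewrite gK.
Qed.

(** Injectivity is automatic on a nonzero fiber, and surjectivity is automatic
    on a zero one. *)
Lemma strong_PSI_fiberP :
  ((exists x : fiber u P, x != 0) -> bijective iota) <->
  forall x, exists c, iota c = x.
Proof.
split=> [bij x|iota_surj [x x0]].
  have [->|x0] := eqVneq x 0; first by exists 0; rewrite rmorph0.
  have [|g _ gK] := bij; first by exists x.
  by exists (g x).
apply: inj_surj_bijective => //; apply: to_fiber_inj => e.
by move/eqP: x0; apply; apply: fiber_trivial.
Qed.

End Fiber.

(** * The kernel of the map to the fiber lies in every A-prime ideal above *)

(** For I A-prime over P this says that the residue field at P maps onto the
    localization of B/I at the image of A \ P; it is stated inside B, where the
    A-prime and the prime ideals I can be treated alike. *)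
Definition generically_onto (A B : comPzRingType) (u : {rmorphism A -> B})
    (I : set B) : Prop :=
  forall b, exists a s, ~ I (u s) /\ I (u s * b - u a).

Section Numerators.
Variables (A B : comPzRingType) (u : {rmorphism A -> B}).
Variables (P : spec A) (I : set B).
Hypothesis Iprime : is_Aprime_ideal u I.
Hypothesis PI : forall a, spec_set P a <-> I (u a).
Local Notation rho := (to_residue P).
Local Notation fsum := (seq (residue_field P * B)).
Implicit Types s t : fsum.

Let idI : is_ideal I. Proof. by case: Iprime => -[]. Qed.

(** [numer d s x] clears denominators: it says that d times the formal sum s is
    represented by x modulo I, each coefficient d c being the class of some
    element of A. It stands for the additive map c ⊗ b |-> cb from the fiber to
    the localization of B/I at the image of A \ P, expressed inside B so that
    this localization need not be constructed. *)
Fixpoint numer (d : A) s (x : B) : Prop :=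
  if s is p :: s' then
    exists2 a, rho a = rho d * p.1 & numer d s' (x - u a * p.2)
  else I x.

Let rho_eq a b : rho a = rho b -> I (u a - u b).
Proof. by move/to_residue_eq/PI; rewrite rmorphB. Qed.

Lemma numerM e d s x : numer d s x -> numer (e * d) s (u e * x).
Proof.
elim: s x => [|p s IH] x /=; first exact: idealMl.
case=> a ea /IH nx; exists (e * a); first by rewrite !rmorphM /= ea mulrA.
by rewrite rmorphM -mulrA -mulrBr.
Qed.

Lemma numer_eq d s x y : numer d s x -> numer d s y -> I (x - y).
Proof.
elim: s x y => [|p s IH] x y /=; first exact: idealB.
case=> a ea nx [b eb ny].
have -> : x - y = (x - u a * p.2 - (y - u b * p.2)) + (u a - u b) * p.2 by ring.
apply: idealD => //; first exact: IH.
by apply: idealMr => //; apply: rho_eq; rewrite ea eb.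
Qed.

Lemma numer_ex s : exists d x, ~ spec_set P d /\ numer d s x.
Proof.
elim: s => [|[c b] s [d [x [nPd nx]]]].
  by exists 1, 0; split; [case: (specP P) => -[] | exact: ideal0].
have [a [e [nPe ->]]] := residue_fieldP c.
exists (e * d), (u e * x + u (a * d) * b); split.
  by case/(specP P).2.
exists (a * d); last by rewrite addrK; apply: numerM.
rewrite !rmorphM /= [X in _ = X * _]mulrC mulrACA mulfV ?to_residue_neq0 //.
by rewrite mulr1 mulrC.
Qed.

Lemma numer_cat d s t z : numer d (s ++ t) z ->
  exists x y, [/\ z = x + y, numer d s x & numer d t y].
Proof.
elim: s z => [|p s IH] z /=.
  by exists 0, z; rewrite add0r; split=> //; apply: ideal0.
case=> a ea /IH [x [y [e nx ny]]].
exists (x + u a * p.2), y; split=> //; last by exists a; rewrite ?addrK.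
by rewrite addrAC -e subrK.
Qed.

(** The map that [numer] encodes respects the tensor relations. Transitivity is
    the step that needs I to be A-prime: the middle sum may only have
    numerators over another denominator e, and u(e) has to be cancelled
    modulo I afterwards. *)
Lemma tensor_equiv_numer s t : tensor_equiv rho u s t ->
  forall d x y, numer d s x -> numer d t y -> I (x - y).
Proof.
elim=> {s t} [s|s t _ IH|s t r _ IHst _ IHtr|s s' t t' _ IHs _ IHt|s t|c c' b
  |c b b'|a c b|b] d x y.
- exact: numer_eq.
- by move=> nx ny; rewrite -opprB; apply: idealN => //; apply: IH nx.
- move=> nx ny; have [e [z [nPe nz]]] := numer_ex t.
  have Ie : I (u e * (x - y)).
    have -> : u e * (x - y) = (u e * x - u d * z) + (u d * z - u e * y) by ring.
    apply: idealD => //.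
      by apply: (IHst (e * d)); [|rewrite mulrC]; apply: numerM.
    by apply: (IHtr (e * d)); [rewrite mulrC|]; apply: numerM.
  by case: (Iprime.2 _ _ Ie) => // /PI.
- case/numer_cat=> [x1 [x2 [-> nx1 nx2]]] /numer_cat[y1 [y2 [-> ny1 ny2]]].
  rewrite opprD addrACA; apply: idealD => //; first exact: IHs nx1 ny1.
  exact: IHt nx2 ny2.
- case/numer_cat=> [x1 [x2 [-> nx1 nx2]]] /numer_cat[y1 [y2 [-> ny1 ny2]]].
  rewrite [y1 + _]addrC opprD addrACA.
  by apply: idealD => //; [apply: numer_eq nx1 ny2 | apply: numer_eq nx2 ny1].
- move=> /= [a ea Ix] [a1 ea1 [a2 ea2 Iy]].
  have e : rho a = rho (a1 + a2) by rewrite rmorphD /= ea ea1 ea2 mulrDr.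
  have -> : x - y = (x - u a * b) - (y - u a1 * b - u a2 * b)
    + (u a - u (a1 + a2)) * b by rewrite rmorphD; ring.
  apply: idealD => //; first exact: idealB.
  by apply: idealMr => //; apply: rho_eq.
- move=> /= [a ea Ix] [a1 ea1 [a2 ea2 Iy]].
  have -> : x - y = (x - u a * (b + b')) - (y - u a1 * b - u a2 * b')
    + ((u a - u a1) * b + (u a - u a2) * b') by ring.
  apply: idealD => //; first exact: idealB.
  by apply: idealD => //; apply: idealMr => //; apply: rho_eq; rewrite ea.
- move=> /= [a1 ea1 Ix] [a2 ea2 Iy].
  have e : rho a1 = rho (a * a2) by rewrite rmorphM /= ea1 ea2 mulrCA.
  have -> : x - y = (x - u a1 * b) - (y - u a2 * (u a * b))
    + (u a1 - u (a * a2)) * b by rewrite rmorphM; ring.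
  apply: idealD => //; first exact: idealB.
  by apply: idealMr => //; apply: rho_eq.
- move=> /= [a ea Ix] Iy.
  have -> : x - y = (x - u a * b) - y + u a * b by ring.
  apply: idealD => //; first exact: idealB.
  apply: idealMr => //; apply/PI/to_residue_eq0.
  by rewrite ea mulr0.
Qed.

(** B/I embeds in its localization at A \ P because I is A-prime, so an element
    of B that dies in the fiber already lies in I. *)
Lemma tensor_inr_eq0 b : tensor_inr rho u b = 0 -> I b.
Proof.
move/tclassP/tensor_equiv_numer=> /(_ 1 b 0); rewrite subr0; apply.
  by exists 1; rewrite /= ?mulr1 // rmorph1 mul1r subrr; apply: ideal0.
exact: ideal0.
Qed.

Lemma fiber_surj_generically_onto :
  (forall x, exists c, to_fiber u P c = x) -> generically_onto u I.
Proof.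
move=> iota_surj b; have [c ec] := iota_surj (tensor_inr rho u b).
have [a [d [nPd ce]]] := residue_fieldP c.
exists a, d; split; first by move/PI.
by apply: tensor_inr_eq0; apply/inr_fracP => //; rewrite -ce.
Qed.

End Numerators.

Section Contraction.
Variables (A B : comPzRingType) (u : {rmorphism A -> B}) (I : set B).
Hypothesis Iprime : is_Aprime_ideal u I.

Lemma Aprime_contr_prime : is_prime_ideal (fun a => I (u a)).
Proof.
have [[[I0 ID IM] I1] IP] := Iprime; split; [split; [split|]|].
- by rewrite rmorph0.
- by move=> x y; rewrite rmorphD; apply: ID.
- by move=> a x; rewrite rmorphM; apply: IM.
- by rewrite rmorph1.
- by move=> x y; rewrite rmorphM => /IP.
Qed.

Lemma Aprime_generically_onto :
  (forall (P : spec A) x, exists c, to_fiber u P c = x) ->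
  generically_onto u I.
Proof.
by move/(_ (Spec Aprime_contr_prime)); apply: fiber_surj_generically_onto.
Qed.

End Contraction.

(** * Primality, residue fields and fibers *)

Section FractionsAndFibers.
Variables (A B : comPzRingType) (u : {rmorphism A -> B}).

Lemma prime_is_Aprime I : is_prime_ideal I -> is_Aprime_ideal u I.
Proof. by case=> pI IP; split=> // a b /IP. Qed.

(** If x is congruent to a/s modulo I, then xy in I forces u(a)y in I, and
    A-primality applies to that product since one factor comes from A. *)
Lemma PSI_of_generically_onto :
  (forall I, is_Aprime_ideal u I -> generically_onto u I) -> PSI_morphism u.
Proof.
move=> onto I AI; have [pI IP] := AI; split=> // x y Ixy.
have idI := pI.1.
have [a [s [nIs Ia]]] := onto I AI x.
have [Iua|nIua] := pselect (I (u a)).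
  by left; case: (IP s x) => //; rewrite -(subrK (u a) (u s * x)); apply: idealD.
right; case: (IP a y) => //.
have -> : u a * y = u s * (x * y) - (u s * x - u a) * y by ring.
by apply: idealB => //; [apply: idealMl | apply: idealMr].
Qed.

(** The analogue of [inr_fracP] for the residue field at Q: the two lemmas share
    their right-hand side when Q is the kernel of B -> fiber. *)
Lemma residue_map_fracP (Q : spec B) a s b : ~ spec_set Q (u s) ->
  to_residue Q b =
    residue_map u Q (to_residue (spec_preimage u Q) a /
                     to_residue (spec_preimage u Q) s) <->
  spec_set Q (u s * b - u a).
Proof.
move=> nQs; have s0 := to_residue_neq0 nQs.
rewrite fmorph_div /= !residue_map_to_residue -to_residue_eq.
rewrite rmorphM /=; split=> [->|<-].
  by rewrite mulrC divfK.
by rewrite mulrAC mulfV // mul1r.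
Qed.

Lemma generically_onto_residue_bij (Q : spec B) :
  generically_onto u Q -> bijective (residue_map u Q).
Proof.
move=> onto; apply: inj_surj_bijective; first exact: fmorph_inj.
have im b : exists c, residue_map u Q c = to_residue Q b.
  have [a [s [nQs Qb]]] := onto b.
  by exists (to_residue _ a / to_residue _ s); apply/esym/residue_map_fracP.
move=> y; have [b [t [_ ->]]] := residue_fieldP y.
have [[c ec] [d ed]] := (im b, im t).
by exists (c / d); rewrite fmorph_div /= ec ed.
Qed.

(** When the fiber is nonzero, the kernel Q of B -> fiber is A-prime, hence
    prime. An element b of B is congruent to a fraction a/s modulo Q by the
    hypothesis on the residue field of Q; membership in Q means vanishing in the
    fiber, so 1 ⊗ b = (a/s) ⊗ 1. *)
Lemma fiber_surj_of_residue_bij (P : spec A) :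
  PSI_morphism u -> (forall Q : spec B, bijective (residue_map u Q)) ->
  forall x, exists c, to_fiber u P c = x.
Proof.
move=> psi bij.
have [e x|ntF] := pselect ((1 : fiber u P) = 0).
  by exists 0; rewrite rmorph0 (fiber_trivial e x).
pose Q := Spec (psi _ (fiber_kernel_Aprime ntF)).
apply: to_fiber_surj => b.
have [g _ /(_ (to_residue Q b)) eb] := bij Q.
have [a [s [nQs ec]]] := residue_fieldP (g (to_residue Q b)).
have nPs : ~ spec_set P s by move/(fiber_contr s ntF).
exists (to_residue P a / to_residue P s); apply/esym/inr_fracP => //.
by apply/(residue_map_fracP (Q := Q)) => //; rewrite -ec eb.
Qed.

End FractionsAndFibers.

Theorem theorem3p4 (A B : comPzRingType) (u : {rmorphism A -> B}) :
  [<-> strong_PSI_morphism u;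
       PSI_morphism u /\ (forall Q : spec B, bijective (residue_map u Q));
       forall P : spec A, dim_le (fiber u P) 1].
Proof.
tfae.
- move=> strong.
  have surj P : forall x, exists c, to_fiber u P c = x.
    exact/strong_PSI_fiberP/strong.
  split=> [|Q]; first apply: PSI_of_generically_onto => I AI.
    exact: Aprime_generically_onto.
  apply/generically_onto_residue_bij/Aprime_generically_onto => //.
  exact/prime_is_Aprime/specP.
- by case=> psi bij P; apply/fiber_dim_le1P/fiber_surj_of_residue_bij.
- by move=> dim P; apply/strong_PSI_fiberP/fiber_dim_le1P/dim.
Qed.
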